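(* For all integers $n\ge 1$ and $0\le m\le t(n)$, $$F(n,m)=\min_{1\le q\le n}\left\{s(q)+F\bigl(n-q,\max\{0,m-t(q)\}\bigr)\right\},$$ where $q$ ranges over integers.
   Context: $\mathbb N$ denotes the positive integers. For a positive integer $q$, $t(q)=\lfloor q^2/4\rfloor$ and $s(q)=\lfloor (q-1)^2/4\rfloor$. For integers $n\ge1$ and $m\ge 0$, $$F(n,m)=\min\left\{\sum_{i=1}^k s(q_i):\ k,q_1,\ldots,q_k\in\mathbb N,\ \sum_{i=1}^k q_i=n,\ \sum_{i=1}^k t(q_i)\ge m\right\},$$ with $F(n,m)=+\infty$ when no such (admissible) partition exists. For $n=0$ the empty partition is allowed, so that $F(0,0)=0$ and $F(0,m)=+\infty$ for $m\ge1$. *)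

(* Defs.v *)
From mathcomp Require Import all_boot all_order all_algebra.
From mathcomp Require Import boolp constructive_ereal.

Set Implicit Arguments.
Unset Strict Implicit.
Unset Printing Implicit Defensive.

Definition t (q : nat) : nat := (q ^ 2) %/ 4.

(* The subtraction is truncated, but [s] is only ever applied to q >= 1. *)
Definition s (q : nat) : nat := ((q - 1) ^ 2) %/ 4.

(* A partition is the list q_1, ..., q_k of its positive parts.  The number k
   of parts is not restricted: [\sum_i q_i = n] forces k >= 1 when n >= 1, and
   leaves only the empty partition when n = 0. *)
Definition admissible (n m : nat) (qs : seq nat) : Prop :=
  [/\ all (fun q => 0 < q) qs,
      \sum_(q <- qs) q = n &
      m <= \sum_(q <- qs) t q].

Definition attained (n m c : nat) : Prop :=
  exists2 qs : seq nat, admissible n m qs & c = \sum_(q <- qs) s q.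

Lemma attained_asbool (n m : nat) :
  (exists c, attained n m c) -> exists c, `[< attained n m c >].
Proof. by case=> c attc; exists c; apply/asboolP. Qed.

(* The minimum lives in N together with +oo, seen inside [\bar int] so that the
   library's order and addition on extended numbers apply. *)
Definition F (n m : nat) : \bar int :=
  match pselect (exists c, attained n m c) with
  | left ex => ((ex_minn (attained_asbool ex))%:Z%:E)%R
  | right _ => +oo%E
  end.

(* Main.v *)
Require Import Defs.
From mathcomp Require Import all_boot all_order all_algebra.
From mathcomp Require Import boolp constructive_ereal.

Import Order.TTheory.

(** Prepending a part [q] to a partition of [n - q] adds [s q] to the cost and [t q] to the sum
    compared with [m]; deleting the head undoes this. Hence an optimal partition of each [n - q]
    extends to one of [n] ([attained_cons], giving [<=]), and an optimal partition of [n] loses its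
    head ([attained_uncons], giving [>=]). *)

Lemma F_le_attained n m c : attained n m c -> (F n m <= c%:Z%:E)%E.
Proof.
move=> attc; rewrite /F; case: pselect => [ex|[]]; last by exists c.
case: ex_minnP => b _ minb; rewrite lee_fin lez_nat.
by apply/minb/asboolP.
Qed.

Variant F_spec n m : \bar int -> Prop :=
  | FAttained c of attained n m c : F_spec n m c%:Z%:E%R
  | FInfinite : F_spec n m +oo%E.

Lemma FP n m : F_spec n m (F n m).
Proof.
rewrite /F; case: pselect => [ex|_]; last exact: FInfinite.
by case: ex_minnP => c /asboolP attc _; apply: FAttained.
Qed.

Lemma attained_cons q n m c : 0 < q -> q <= n ->
  attained (n - q) (m - t q) c -> attained n m (s q + c).
Proof.
move=> q_gt0 le_qn [qs [qs_gt0 sum_qs le_m] ->].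
exists (q :: qs); last by rewrite big_cons.
by split; rewrite /= ?q_gt0 // big_cons ?sum_qs ?subnKC // -leq_subLR.
Qed.

Lemma attained_uncons n m c : 0 < n -> attained n m c ->
  exists q d, [/\ 0 < q <= n, attained (n - q) (m - t q) d & c = s q + d].
Proof.
move=> n_gt0 [[|q qs] [qs_gt0 sum_qs le_m] ->].
  (* The empty partition is excluded by [0 < n]. *)
  by rewrite -sum_qs big_nil in n_gt0.
have /andP[q_gt0 {}qs_gt0] := qs_gt0; rewrite !big_cons in sum_qs le_m *.
exists q, (\sum_(j <- qs) s j); split=> //.
  by rewrite q_gt0 -sum_qs leq_addr.
exists qs => //; split=> //; first by rewrite -sum_qs addKn.
by rewrite leq_subLR.
Qed.

(* [m - t q] is truncated subtraction on nat, i.e. max {0, m - t(q)}.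
   The minimum over the nonempty range 1 <= q <= n is an iterated [Order.min]
   whose neutral element is the top element +oo. *)
Theorem theorem1p5 (n m : nat) (hn : 1 <= n) (hm : m <= t n) :
  F n m = \big[Order.min/+oo%E]_(1 <= q < n.+1)
            ((s q)%:Z%:E + F (n - q)%N (m - t q)%N)%E.
Proof.
apply: le_anti; apply/andP; split.
  rewrite big_seq; apply: le_bigmin => [|q]; first exact: leey.
  rewrite mem_index_iota ltnS => /andP[q_gt0 le_qn].
  case: (FP (n - q)) => [c attc|]; last by rewrite addey ?leey.
  by rewrite -EFinD -PoszD; apply/F_le_attained/attained_cons.
case: (FP n m) => [c attc|]; last exact: leey.
(* The head [q] of an optimal partition is the index whose term bounds the minimum. *)
have [q [d [/andP[q_gt0 le_qn] attd ->]]] := attained_uncons _ _ _ hn attc.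
apply: (bigmin_inf_seq _ q) => //; first by rewrite mem_index_iota q_gt0 ltnS.
by rewrite PoszD EFinD leeD2l // F_le_attained.
Qed.
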